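(* Let $A$ be a Noetherian commutative ring, $C$ a finitely generated $A$-module and $J_1, \ldots, J_d \subseteq A$ finitely many ideals. Suppose that for each $1\leq i\leq d$, $\{I_{i,m}\}_{m\geq 0}$ is a family of ideals of $A$ satisfying: (i) $I_{i,0} = A$; (ii) $J_i^{m}\subseteq I_{i,m}$ for all $m\geq 0$; (iii) $I_{i,n}\subseteq I_{i,m}$ for all integers $0\le m\leq n$; (iv) $J_i^{r}\cdot I_{i,s} \subseteq I_{i,r+s}$ for all $r,s\ge 0$. Then there exists $k = (k_1, \ldots, k_d) \in \mathbb{N}_0^d$ such that for all $n = (n_1, \ldots, n_d)\in\mathbb{N}_0^d$ with $n\geq k$, \[\operatorname{Ass}_A\bigl(I_{1,n_1}\cdots I_{d,n_d}C/J_1^{n_1} \cdots J_d^{n_d}C\bigr) = \operatorname{Ass}_A\bigl(I_{1,k_1}\cdots I_{d,k_d}C/J_1^{k_1} \cdots J_d^{k_d}C\bigr).\]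
   Context: $\mathbb{N}_0$ denotes the set of non-negative integers. For $n,k\in\mathbb{N}_0^d$, $n\geq k$ means $n_i\geq k_i$ for all $1\leq i\leq d$. $\operatorname{Ass}_A(N)$ denotes the set of associated primes of the $A$-module $N$. *)

(* Defs.v *)
From HB Require Import structures.
From mathcomp Require Import all_boot all_algebra.
From mathcomp Require Import boolp classical_sets.
Set Implicit Arguments.
Unset Strict Implicit.
Unset Printing Implicit Defensive.
Import GRing.Theory.
Local Open Scope ring_scope.
Local Open Scope quotient_scope.

(* GRing.SubmodClosed is stated over semimodules and does not provide closure
   under opposite, hence this record.  Submodules are boolean predicates; with
   classical logic (boolp) every subset of V is one. *)
Record submodule (R : pzRingType) (V : lmodType R) := Submodule {
  submod_pred :> {pred V};
  submod_predP : submod_closed submod_pred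
}.

HB.instance Definition _ (R : pzRingType) (V : lmodType R) (S : submodule V) :=
  GRing.isSubmodClosed.Build R V (submod_pred S) (submod_predP S).

Notation ideal A := (submodule A^o).

Section SubmoduleType.
Variables (R : pzRingType) (V : lmodType R) (S : submodule V).

Record submod_type := SubmodType {
  submod_val : V;
  submod_valP : submod_val \in S
}.

HB.instance Definition _ := [isSub for submod_val].
HB.instance Definition _ := [Choice of submod_type by <:].
HB.instance Definition _ := [SubChoice_isSubZmodule of submod_type by <:].
HB.instance Definition _ := [SubZmodule_isSubLmodule of submod_type by <:].

End SubmoduleType.

Section QuotientModule.
Variables (R : pzRingType) (V : lmodType R) (S : submodule V).

(* Quotient.quot only carries a zmodType structure; the scaling is added. *)
Definition quot_mod := Quotient.quot S.
HB.instance Definition _ := GRing.Zmodule.on quot_mod.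
HB.instance Definition _ := EqQuotient.on quot_mod.

Definition quot_scale (a : R) (x : quot_mod) : quot_mod :=
  \pi_quot_mod (a *: repr x).

Lemma pi_quotE (x y : V) :
  (\pi_quot_mod x == \pi_quot_mod y) = (x - y \in S).
Proof. exact: (esym (Quotient.idealrBE S x y)). Qed.

Lemma pi_quotD : {morph \pi_quot_mod : x y / x + y}.
Proof. exact: Quotient.pi_add. Qed.

Lemma pi_quotZ a x : \pi_quot_mod (a *: x) = quot_scale a (\pi_quot_mod x).
Proof.
apply/eqP; rewrite pi_quotE -scalerBr rpredZ //.
by rewrite -pi_quotE reprK.
Qed.

Fact quot_scalerA a b v : quot_scale a (quot_scale b v) = quot_scale (a * b) v.
Proof.
by rewrite -[v]reprK -(pi_quotZ b) -(pi_quotZ a) -(pi_quotZ (a * b)) scalerA.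
Qed.

Fact quot_scale1r : left_id 1 quot_scale.
Proof. by move=> v; rewrite -[v]reprK -(pi_quotZ 1) scale1r. Qed.

Fact quot_scalerDr : right_distributive quot_scale +%R.
Proof.
move=> a u v; rewrite -[u]reprK -[v]reprK -pi_quotD.
by rewrite -3!(pi_quotZ a) scalerDr pi_quotD.
Qed.

Fact quot_scalerDl v : {morph quot_scale^~ v : a b / a + b}.
Proof.
move=> a b; rewrite -[v]reprK -(pi_quotZ (a + b)) -(pi_quotZ a) -(pi_quotZ b).
by rewrite scalerDl pi_quotD.
Qed.

HB.instance Definition _ := GRing.Zmodule_isLmodule.Build R quot_mod
  quot_scalerA quot_scale1r quot_scalerDr quot_scalerDl.

End QuotientModule.

Section SubQuotient.
Variables (R : pzRingType) (V : lmodType R) (M N : submodule V).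

Definition restr_pred : {pred submod_type M} := fun x => submod_val x \in N.

Fact restr_closed : submod_closed restr_pred.
Proof.
split=> [|a x y Nx Ny]; rewrite unfold_in; first exact: (rpred0 N).
have -> : submod_val (a *: x + y) = a *: submod_val x + submod_val y.
  by rewrite -[LHS]/(val (a *: x + y)) raddfD; congr (_ + _).
by rewrite rpredD ?rpredZ.
Qed.

Definition restr : submodule (submod_type M) := Submodule restr_closed.

(* The module M / N when N is contained in M, and M / (M \cap N) in general. *)
Definition subquot : lmodType R := quot_mod restr.

End SubQuotient.

Section Operations.
Variable A : comPzRingType.

Section FullSubmodule.
Variable V : lmodType A.

Definition full_pred : {pred V} := fun=> true.

Fact full_closed : submod_closed full_pred.
Proof. by []. Qed.

Definition full : submodule V := Submodule full_closed.

End FullSubmodule.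

Section Product.
Variables (V : lmodType A) (I : ideal A) (M : submodule V).

Definition smul_pred : {pred V} := fun x =>
  `[< exists s : seq (A * V),
        {in s, forall p, p.1 \in I /\ p.2 \in M}
        /\ x = \sum_(p <- s) p.1 *: p.2 >].

Fact smul_closed : submod_closed smul_pred.
Proof.
split; first by apply/asboolP; exists [::]; rewrite big_nil.
move=> a x y /asboolP[s [sP ->]] /asboolP[t [tP ->]]; apply/asboolP.
exists ([seq (p.1, a *: p.2) | p <- s] ++ t); split.
  move=> p; rewrite mem_cat => /orP[/mapP[q /sP[qI qM] ->]|/tP] //=.
  by split=> //; apply: rpredZ.
rewrite big_cat big_map scaler_sumr; congr (_ + _).
by apply: eq_bigr => p _; rewrite /= !scalerA mulrC.
Qed.

(* The submodule I M; for V = A^o, the product of two ideals. *)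
Definition smul : submodule V := Submodule smul_closed.

End Product.

Definition ideal_exp (J : ideal A) (m : nat) : ideal A :=
  iter m (smul J) (full A^o).

Definition ideal_prod (d : nat) (I : 'I_d -> ideal A) : ideal A :=
  \big[@smul A^o/full A^o]_(i < d) I i.

Definition finitely_generated (M : lmodType A) : Prop :=
  exists s : seq M, forall x : M,
    exists c : 'I_(size s) -> A, x = \sum_(i < size s) c i *: s`_i.

Definition noetherian : Prop :=
  forall I : ideal A, finitely_generated (submod_type I).

(* MathComp's prime_idealr requires a nonzero ring; this is the same notion
   over a possibly zero one. *)
Definition prime_ideal (p : {pred A}) : Prop :=
  [/\ submod_closed (p : {pred A^o}), 1 \notin p &
      forall u v : A, u * v \in p -> (u \in p) || (v \in p)].

Definition annihilator (M : lmodType A) (x : M) : {pred A} :=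
  fun a => a *: x == 0.

Definition Ass (M : lmodType A) : set {pred A} :=
  [set p | prime_ideal p /\ exists x : M, p = annihilator x]%classic.

End Operations.

(* Main.v *)
(* Write JC n and IC n for J^n C and I_n C, and e_j for the j-th unit multi-index.
   By (iii) there is a natural map E_(n+e_j) -> E_n on E_n = IC n / JC n, with
   kernel H^j_n = (JC n :&: IC (n+e_j)) / JC (n+e_j), so
     Ass H^j_n <= Ass E_(n+e_j) <= Ass E_n :|: Ass H^j_n.
   By (iv), the direct sum of the H^j_n is a graded submodule of the direct sum
   G^j of the JC n / JC (n+e_j), a Noetherian module over the Rees algebra of
   J_1, ..., J_d.  Hence only finitely many primes occur in all these modules,
   and in large degrees no nonzero element of G^j is killed by some J_i; by the
   latter, Ass H^j_n increases with n and therefore becomes constant.  Then,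
   for large n, Ass H^j_n is already contained in Ass E_n, so that Ass E_n
   decreases with n, and therefore becomes constant too. *)
Require Import Defs.
From HB Require Import structures.
From mathcomp Require Import all_boot all_algebra.
From mathcomp Require Import boolp classical_sets functions.
Set Implicit Arguments.
Unset Strict Implicit.
Unset Printing Implicit Defensive.
Local Open Scope ring_scope.
Import GRing.Theory.
Local Open Scope classical_set_scope.

(** * Ascending chains and maximal elements *)

Lemma ascending_le (T : Type) (N : nat -> set T) :
  (forall m, N m `<=` N m.+1) -> forall m n, (m <= n)%N -> N m `<=` N n.
Proof.
move=> incN m n /subnK <-; elim: (n - m)%N => [|l IHl] //=.
by move=> x /IHl; rewrite addSn; apply: incN.
Qed.

(** Otherwise each element of [P] has a successor in [P] that is not [le] below it; iterating a
    choice of successors from [t0] contradicts the chain condition. *)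
Lemma exists_maximal (T : Type) (P : T -> Prop) (le : T -> T -> Prop) t0 :
    P t0 ->
    (forall t : nat -> T, (forall m, P (t m)) -> (forall m, le (t m) (t m.+1)) ->
       exists m, le (t m.+1) (t m)) ->
  exists t, P t /\ forall u, P u -> le t u -> le u t.
Proof.
move=> Pt0 acc; apply: contrapT => nomax.
have step t : exists u, P t -> [/\ P u, le t u & ~ le u t].
  have [Pt|nPt] := pselect (P t); last by exists t.
  apply: contrapT => nou; apply: nomax; exists t; split=> // u Pu letu.
  by apply: contrapT => nle; apply: nou; exists u.
have [f fP] := choice step.
pose t m := iter m f t0.
have Pt m : P (t m) by elim: m => //= m /fP[].
have [|m] := acc t Pt; first by move=> m; have [] := fP _ (Pt m).
by have [_ _] := fP _ (Pt m).
Qed.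

(** The diagonal is constant from some [e] on, which settles the rows [k >= e]: a point of [L k m]
    lies on the diagonal, so in [L e e] and in [L k e]. The finitely many rows below [e] stabilise
    one by one. *)
Lemma double_chain_stationary (T : Type) (L : nat -> nat -> set T) :
    (forall k m, L k m `<=` L k.+1 m) -> (forall k m, L k m `<=` L k m.+1) ->
    (forall k, exists m0, forall m, L k m `<=` L k m0) ->
    (exists m0, forall m, L m m `<=` L m0 m0) ->
  exists m0, forall k m, L k m `<=` L k m0.
Proof.
move=> inck incm acck [e acce].
have lek m j k : (j <= k)%N -> L j m `<=` L k m.
  by apply: (@ascending_le _ (L^~ m)) => i; apply: inck.
have lem k : forall m n, (m <= n)%N -> L k m `<=` L k n.
  by apply: ascending_le => i; apply: incm.
have [b bP] := choice acck.
exists (maxn e (\max_(k < e) b k)) => k m x.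
have [lt_ke|le_ek] := ltnP k e => Lx.
  apply: (lem _ (b k)); last exact: bP Lx.
  by rewrite leq_max (leq_bigmax (Ordinal lt_ke)) orbT.
apply: (lem _ e); first by rewrite leq_maxl.
apply: (lek _ e) => //; apply: (acce (maxn k m)).
by apply: (lem _ m); [exact: leq_maxr|apply: lek Lx; exact: leq_maxl].
Qed.

(** * Hilbert's basis theorem for groups with operators *)

Section OperatorSubgroups.
Variable W : zmodType.
Implicit Types (S : set (W -> W)) (M N : set W) (phi : W -> W).

Definition stable_subgroup S N :=
  [/\ N 0, forall x y, N x -> N y -> N (x - y) &
      forall s x, S s -> N x -> N (s x)].

(** Relative to a set of operators, so that one notion serves [A]-modules and modules over the Rees
    algebra. *)
Definition noetherian_for S M := forall N : nat -> set W,
  (forall m, stable_subgroup S (N m)) -> (forall m, N m `<=` M) ->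
  (forall m, N m `<=` N m.+1) -> exists m0, forall m, N m `<=` N m0.

Lemma stable_subgroupD S N x y : stable_subgroup S N ->
  N x -> N y -> N (x + y).
Proof.
move=> [N0 subN _] Nx Ny; rewrite -[y]opprK; apply: (subN) => //.
by rewrite -[- y]add0r; apply: subN.
Qed.

Lemma morphB0 phi : {morph phi : x y / x - y} -> phi 0 = 0.
Proof. by move=> phiB; rewrite -{1}(subrr 0) phiB subrr. Qed.

Lemma morphBD phi : {morph phi : x y / x - y} -> {morph phi : x y / x + y}.
Proof.
move=> phiB x y; rewrite -{1}[y]opprK phiB -{1}[- y]add0r phiB (morphB0 phiB).
by rewrite sub0r opprK.
Qed.

Section Adjunction.
Variables (S : set (W -> W)) (phi : W -> W) (M : set W).
Hypothesis SB : forall s, S s -> {morph s : x y / x - y}.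
Hypothesis phiB : {morph phi : x y / x - y}.
Hypothesis phiS : forall s, S s -> forall x, phi (s x) = s (phi x).
Hypothesis Mstab : stable_subgroup S M.

(* [truncated_span k] is M + phi M + ... + phi^(k-1) M. *)
Fixpoint truncated_span k : set W :=
  if k is k'.+1
  then [set f | exists w g,
          [/\ M w, truncated_span k' g & f = iter k' phi w + g]]
  else [set 0].

Definition adjoin_operator : set W := [set f | exists k, truncated_span k f].

Lemma iter_phiB k : {morph iter k phi : x y / x - y}.
Proof. by elim: k => // k IHk x y /=; rewrite IHk phiB. Qed.

Lemma iter_phiS k s x : S s -> iter k phi (s x) = s (iter k phi x).
Proof. by move=> Ss; elim: k => //= k ->; rewrite phiS. Qed.

Lemma truncated_span_incr k : truncated_span k `<=` truncated_span k.+1.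
Proof.
move=> f fk; exists 0, f; split=> //; first by case: Mstab.
by rewrite (morphB0 (iter_phiB k)) add0r.
Qed.

Lemma truncated_span_stable k : stable_subgroup S (truncated_span k).
Proof.
have [M0 MB MS] := Mstab.
elim: k => [|k [IH0 IHB IHS]] /=.
  split=> // [x y -> ->|s x Ss ->]; first by rewrite subrr.
  exact: morphB0 (SB Ss).
split.
- exists 0, 0; split=> //.
  by rewrite (morphB0 (iter_phiB k)) addr0.
- move=> _ _ [w [g [Mw gk ->]]] [w' [g' [Mw' gk' ->]]].
  exists (w - w'), (g - g'); split; [exact: MB|exact: IHB|].
  by rewrite iter_phiB opprD addrACA.
- move=> s _ Ss [w [g [Mw gk ->]]].
  exists (s w), (s g); split; [exact: MS|exact: IHS|].
  rewrite (morphBD (SB Ss)); congr (_ + _).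
  by rewrite iter_phiS.
Qed.

Lemma truncated_span_phi k f :
  truncated_span k f -> truncated_span k.+1 (phi f).
Proof.
elim: k f => [|k IHk] f.
  by move=> ->; rewrite (morphB0 phiB); have [] := truncated_span_stable 1.
move=> [w [g [Mw gk ->]]]; exists w, (phi g); split=> //; first exact: IHk.
by rewrite (morphBD phiB).
Qed.

Lemma truncated_span_le k l : (k <= l)%N ->
  truncated_span k `<=` truncated_span l.
Proof. by apply: ascending_le => i; apply: truncated_span_incr. Qed.

Lemma adjoin_operator_stable : stable_subgroup (phi |` S) adjoin_operator.
Proof.
split.
- by exists 0%N.
- move=> x y [k xk] [l yl]; exists (maxn k l).
  have [_ IHB _] := truncated_span_stable (maxn k l).
  by apply: IHB; [apply: truncated_span_le xk|apply: truncated_span_le yl];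
    rewrite leq_max leqnn ?orbT.
- move=> s x [->|Ss] [k xk]; first by exists k.+1; apply: truncated_span_phi.
  by exists k; have [_ _] := truncated_span_stable k; apply.
Qed.

Lemma sub_adjoin_operator : M `<=` adjoin_operator.
Proof. by move=> w Mw; exists 1%N, w, 0; split; rewrite //= addr0. Qed.

(* Degree-k leading coefficients, as in the proof of Hilbert's basis theorem,
   with phi in the role of the indeterminate. *)
Definition leading k N : set W :=
  [set w | M w /\ exists g, truncated_span k g /\ N (iter k phi w + g)].

Lemma leading_stable k N : stable_subgroup S N ->
  stable_subgroup S (leading k N).
Proof.
have [M0 MB MS] := Mstab.
have [F0 FB FS] := truncated_span_stable k.
move=> [N0 NB NS]; split.
- split=> //; exists 0; split=> //.
  by rewrite (morphB0 (iter_phiB k)) addr0.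
- move=> x y [Mx [g [gk Ng]]] [My [h [hk Nh]]]; split; first exact: MB.
  exists (g - h); split; first exact: FB.
  by rewrite iter_phiB addrACA -opprD; apply: NB.
- move=> s x Ss [Mx [g [gk Ng]]]; split; first exact: MS.
  exists (s g); split; first exact: FS.
  by rewrite iter_phiS // -(morphBD (SB Ss)); apply: NS.
Qed.

(** Cancel leading terms: for an element of [N'] there is an element of [N] with the same top term,
    and their difference lies in [N'] with fewer terms. *)
Lemma leading_separates N N' : stable_subgroup S N -> stable_subgroup S N' ->
    N `<=` N' -> (forall k, leading k N' `<=` leading k N) ->
  N' `&` adjoin_operator `<=` N.
Proof.
move=> Nstab N'stab NN' leadN f [N'f [k]].
elim: k f N'f => [|k IHk] f N'f; first by move=> ->; case: Nstab.
move=> [w [g [Mw gk Df]]].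
have [_ [h [hk Nh]]] : leading k N w.
  by apply: leadN; split=> //; exists g; rewrite -Df.
have -> : f = (iter k phi w + h) + (g - h) by rewrite Df addrACA subrr addr0.
apply: (stable_subgroupD Nstab Nh); apply: IHk; last first.
  by have [_ FB _] := truncated_span_stable k; apply: FB.
have -> : g - h = f - (iter k phi w + h) by rewrite Df opprD addrACA subrr add0r.
by have [_ N'B _] := N'stab; apply: N'B => //; apply: NN'.
Qed.

(** The sets [leading k (N m)] increase with [m], and with [k] by applying [phi]. They become
    stationary in [m] uniformly in [k], and [leading_separates] carries this over to [N]. *)
Lemma noetherian_adjoin_operator :
  noetherian_for S M -> noetherian_for (phi |` S) adjoin_operator.
Proof.
move=> noethM N Nstab NM Ninc.
have NstabS m : stable_subgroup S (N m).
  by have [N0 NB NS] := Nstab m; split=> // s x Ss; apply: NS; right.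
have leadM k m : leading k (N m) `<=` M by move=> w [].
have leadS k m : leading k (N m) `<=` leading k (N m.+1).
  by move=> w [Mw [g [gk Ng]]]; split=> //; exists g; split=> //; apply: Ninc.
have leadSk k m : leading k (N m) `<=` leading k.+1 (N m).
  move=> w [Mw [g [gk Ng]]]; split=> //; exists (phi g); split.
    exact: truncated_span_phi.
  by rewrite /= -(morphBD phiB); have [_ _ NS] := Nstab m; apply: NS => //; left.
have [||m0 m0P] := @double_chain_stationary _ (fun k m => leading k (N m)) leadSk leadS.
- by move=> k; apply: noethM => // m; apply: leading_stable.
- apply: noethM => // m; first exact: leading_stable.
  exact: subset_trans (leadS _ _) (@leadSk _ _).
exists m0 => m x Nx.
have [le_m|le_m] := leqP m m0; first exact: ascending_le le_m x Nx.
apply: (leading_separates (NstabS m0) (NstabS m)) => //.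
- by apply: ascending_le => //; apply: ltnW.
- by split=> //; apply: NM Nx.
Qed.

End Adjunction.
End OperatorSubgroups.

(** * Multi-indices: induction and eventual constancy *)

Section MultiIndices.
Variable d : nat.
Implicit Types (n k : 'I_d -> nat) (i j : 'I_d).

Definition zero_index : 'I_d -> nat := fun=> 0%N.
Definition incr n j : 'I_d -> nat := fun i => (n i + (i == j))%N.
Definition decr n j : 'I_d -> nat := fun i => (n i - (i == j))%N.

Lemma incrC n i j : incr (incr n i) j = incr (incr n j) i.
Proof. by apply: funext => l; rewrite /incr addnAC. Qed.

Lemma decrC n i j : decr (decr n i) j = decr (decr n j) i.
Proof. by apply: funext => l; rewrite /decr subnAC. Qed.

Lemma incrK n j : decr (incr n j) j = n.
Proof. by apply: funext => l; rewrite /decr addnK. Qed.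

Lemma decrK n j : (0 < n j)%N -> incr (decr n j) j = n.
Proof.
move=> nj; apply: funext => l; rewrite /incr subnK //.
by case: eqP => // ->.
Qed.

Lemma multi_index_ind (P : ('I_d -> nat) -> Prop) k :
    P k ->
    (forall n j, (forall i, (k i <= n i)%N) -> P n -> P (incr n j)) ->
  forall n, (forall i, (k i <= n i)%N) -> P n.
Proof.
move=> Pk step n; have [m] := ubnP (\sum_i n i); elim: m n => // m IHm n.
rewrite ltnS => le_m le_kn.
have [[j lt_kn]|le_nk] := pselect (exists j, (k j < n j)%N); last first.
  suff -> : n = k by [].
  apply: funext => i; apply/eqP; rewrite eqn_leq le_kn andbT leqNgt.
  by apply/negP => lt_kn; apply: le_nk; exists i.
rewrite -(decrK (leq_ltn_trans (leq0n _) lt_kn)).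
have le_kd i : (k i <= decr n j i)%N.
  rewrite /decr; case: eqP => [->|_]; last by rewrite subn0.
  by rewrite subn1 -ltnS (ltn_predK lt_kn).
apply: step => //; apply: IHm => //; apply: leq_trans le_m.
rewrite [leqRHS](bigD1 j) //= (bigD1 j) //= /decr eqxx subn1.
rewrite -addSn (ltn_predK lt_kn) leq_add2l; apply: leq_sum => i _.
exact: leq_subr.
Qed.

(** A [p] that satisfies [P] somewhere beyond [k] does so from there on; [k'] is the coordinatewise
    maximum of [k] and one such index for each of these [p] in the finite list. *)
Lemma eventually_stationary (T : eqType) (L : seq T)
    (P : ('I_d -> nat) -> T -> Prop) k :
    (forall n j p, (forall i, (k i <= n i)%N) -> P n p -> P (incr n j) p) ->
  exists k', (forall i, (k i <= k' i)%N) /\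
    forall n p, p \in L -> (forall i, (k' i <= n i)%N) -> P n p <-> P k' p.
Proof.
move=> Pinc.
have Pmon n n' p : (forall i, (k i <= n i)%N) -> (forall i, (n i <= n' i)%N) ->
    P n p -> P n' p.
  move=> le_kn le_nn' Pn; move: n' le_nn'; apply: multi_index_ind => // n' j le_nn'.
  by apply: Pinc => i; apply: leq_trans (le_kn i) (le_nn' i).
suff [k' [le_k k'P]] : exists k', (forall i, (k i <= k' i)%N) /\
    forall n p, p \in L -> (forall i, (k i <= n i)%N) -> P n p -> P k' p.
  exists k'; split=> // n p pL le_n; split=> [|Pk']; last exact: Pmon Pk'.
  by apply: k'P => // i; apply: leq_trans (le_k i) (le_n i).
elim: L => [|q L [k' [le_k k'P]]]; first by exists k.
have [[m [le_m Pm]]|noP] :=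
  pselect (exists m, (forall i, (k i <= m i)%N) /\ P m q); last first.
  exists k'; split=> // n p; rewrite inE => /orP[/eqP -> le_n Pn|]; last exact: k'P.
  by case: noP; exists n.
exists (fun i => maxn (k' i) (m i)); split=> [i|n p].
  by rewrite leq_max le_k.
rewrite inE => /orP[/eqP -> _ _|pL le_n Pn].
  by apply: Pmon Pm => // i; apply: leq_maxr.
by apply: (Pmon k' _ _ le_k) (k'P _ _ pL le_n Pn) => i; apply: leq_maxl.
Qed.

End MultiIndices.

(** * Submodules as subgroups stable under scalings *)

Definition scalings (A : comPzRingType) (V : lmodType A) : set (V -> V) :=
  [set s | exists a : A, s = *:%R a].

Section Scalings.
Variables (A : comPzRingType) (V : lmodType A).

Lemma stable_subgroup_sum (I : Type) (r : seq I) (F : I -> V) (N : set V) :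
    stable_subgroup (@scalings A V) N -> (forall i, N (F i)) ->
  N (\sum_(i <- r) F i).
Proof.
move=> Nstab NF; elim: r => [|i r IHr]; first by rewrite big_nil; case: Nstab.
by rewrite big_cons; apply: stable_subgroupD Nstab _ _.
Qed.

Lemma scalings_stableZ (N : set V) a x :
  stable_subgroup (@scalings A V) N -> N x -> N (a *: x).
Proof. by move=> [_ _ NZ]; apply: (NZ ( *:%R a)); exists a. Qed.

Lemma submod_val_sum (N : submodule V) m (c : 'I_m -> A)
    (F : 'I_m -> submod_type N) :
  submod_val (\sum_(i < m) c i *: F i) = \sum_(i < m) c i *: submod_val (F i).
Proof.
rewrite -[LHS]/(val _) raddf_sum; exact: eq_bigr.
Qed.

Lemma submodule_stable (N : submodule V) :
  stable_subgroup (@scalings A V) [set x | x \in N].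
Proof.
split=> [|x y|_ x [a ->]]; [exact: rpred0|exact: rpredB|exact: rpredZ].
Qed.

Lemma stable_submod_closed (N : set V) : stable_subgroup (@scalings A V) N ->
  submod_closed (fun x : V => `[< N x >]).
Proof.
move=> Nstab; split; first by apply/asboolP; case: Nstab.
move=> a x y /asboolP Nx /asboolP Ny; apply/asboolP.
by apply: (stable_subgroupD Nstab) => //; apply: scalings_stableZ.
Qed.

End Scalings.

(** The union of the chain is an ideal, and a member containing its finitely many generators is the
    whole union. *)
Lemma noetherian_ideals (A : comPzRingType) : noetherian A ->
  noetherian_for (@scalings A A^o) setT.
Proof.
move=> noethA N Nstab _ Ninc.
pose U : set A^o := [set a | exists m, N m a].
have Ustab : stable_subgroup (@scalings A A^o) U.
  split; first by exists 0%N; case: (Nstab 0%N).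
  - move=> x y [l Nx] [m Ny]; exists (maxn l m).
    have [_ NB _] := Nstab (maxn l m).
    by apply: NB; [apply: ascending_le Nx|apply: ascending_le Ny] => //;
      rewrite leq_max leqnn ?orbT.
  - by move=> s x Ss [m Nx]; exists m; case: (Nstab m) => _ _; apply.
pose I : ideal A := Submodule (stable_submod_closed Ustab).
have [s gen] := noethA I.
have Us (i : 'I_(size s)) : exists m, N m (val s`_i).
  exact/asboolP/(valP s`_i).
have [b bP] := choice Us.
exists (\max_i b i) => m x Nx.
have xI : x \in I by apply/asboolP; exists m.
have [c Dx] := gen (SubmodType xI).
have /= -> := etrans (congr1 (@submod_val _ _ I) Dx) (submod_val_sum c _).
apply: stable_subgroup_sum => // i; apply: scalings_stableZ => //.
by apply: ascending_le (bP i) => //; apply: leq_bigmax.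
Qed.

(** * The chain condition for finitely generated modules *)

Section NoetherianModules.
Variables (A : comPzRingType) (V : lmodType A).

(** A chain is controlled by its intersections with [M] and by the ideals of coefficients of [c].
    Once both are stationary, an element of a later member differs from one of the current member by
    an element of [M], which the stationary intersection contains. *)
Lemma noetherian_adjoin_generator (M : set V) (c : V) : noetherian A ->
    stable_subgroup (@scalings A V) M -> noetherian_for (@scalings A V) M ->
  noetherian_for (@scalings A V) [set x | exists a w, M w /\ x = a *: c + w].
Proof.
move=> noethA Mstab noethM N Nstab NM Ninc.
have [m1 m1P] : exists m1, forall m, N m `&` M `<=` N m1 `&` M.
  apply: noethM => m; [|by move=> x []|by move=> x [/Ninc ? ?]].
  have [N0 NB NZ] := Nstab m; have [M0 MB MZ] := Mstab.
  split=> [|x y [? ?] [? ?]|s x Ss [? ?]]; first by [].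
  - by split; [apply: NB|apply: MB].
  - by split; [apply: NZ|apply: MZ].
pose L m : set A^o := [set a | exists w, M w /\ N m (a *: c + w)].
have [m2 m2P] : exists m2, forall m, L m `<=` L m2.
  apply: noetherian_ideals => // m; last first.
    by move=> a [w [Mw Nw]]; exists w; split=> //; apply: Ninc.
  have [N0 NB NZ] := Nstab m; have [M0 MB MZ] := Mstab; split.
  - by exists 0; split; rewrite // scale0r addr0.
  - move=> a b [w [Mw Nw]] [v [Mv Nv]]; exists (w - v); split; first exact: MB.
    by rewrite scalerBl addrACA -opprD; apply: NB.
  - move=> _ a [e ->] [w [Mw Nw]]; exists (e *: w).
    split; first exact: scalings_stableZ.
    by rewrite -scalerA -scalerDr; apply: scalings_stableZ.
exists (maxn m1 m2) => m.
have {}m1P l : N l `&` M `<=` N (maxn m1 m2).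
  by move=> x /m1P[Nx _]; apply: ascending_le Nx => //; apply: leq_maxl.
move=> x Nx; have [a [w [Mw Dx]]] := NM _ _ Nx.
have [v [Mv Nv]] : L m2 a by apply: (m2P m); exists w; rewrite -Dx.
have {}Nv := ascending_le Ninc (leq_maxr m1 m2) Nv.
have -> : x = (a *: c + v) + (w - v) by rewrite Dx addrACA subrr addr0.
apply: stable_subgroupD (Nstab _) (Nv) _; apply: (m1P (maxn m (maxn m1 m2))).
split; last by have [_ MB _] := Mstab; apply: MB.
have -> : w - v = x - (a *: c + v) by rewrite Dx opprD addrACA subrr add0r.
have [_ NB _] := Nstab (maxn m (maxn m1 m2)).
by apply: NB; [apply: ascending_le Nx|apply: ascending_le Nv];
  rewrite // ?leq_maxl ?leq_maxr.
Qed.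

Lemma noetherian_module : noetherian A -> finitely_generated V ->
  noetherian_for (@scalings A V) setT.
Proof.
move=> noethA [s gen].
pose span := fix span s : set V := if s is c :: s'
  then [set x | exists a w, span s' w /\ x = a *: c + w] else [set 0].
suff spanP r : [/\ stable_subgroup (@scalings A V) (span r),
    noetherian_for (@scalings A V) (span r) &
    forall i, (i < size r)%N -> span r r`_i].
  have [span_s noeth_s gen_s] := spanP s.
  move=> N Nstab _; apply: noeth_s => // m x _; have [c ->] := gen x.
  by apply: stable_subgroup_sum => // i; apply: scalings_stableZ => //; apply: gen_s.
elim: r => [|c r [span_r noeth_r gen_r]].
  split=> //.
    by split=> // [x y -> ->|_ x [a ->] ->]; rewrite /= ?subrr ?scaler0.
  by move=> N Nstab N0 _; exists 0%N => m x /N0 ->; case: (Nstab 0%N).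
split; last 1 first.
- move=> [|i] /= lt_i; last by exists 0, r`_i; rewrite scale0r add0r; split=> //; apply: gen_r.
  by exists 1, 0; rewrite scale1r addr0; split=> //; case: span_r.
- have [M0 MB MZ] := span_r; split.
  + by exists 0, 0; rewrite scale0r addr0.
  + move=> _ _ [a [w [Mw ->]]] [b [v [Mv ->]]]; exists (a - b), (w - v).
    by split; [exact: MB|rewrite scalerBl addrACA opprD].
  + move=> _ _ [e ->] [a [w [Mw ->]]]; exists (e * a), (e *: w).
    by split; [exact: scalings_stableZ|rewrite /= scalerDr scalerA].
- exact: noetherian_adjoin_generator.
Qed.

(** For fixed [c] the scalars sending [c] into [N] form an ideal, so generators decide. This is why
    finitely many operators suffice for the Rees algebra. *)
Lemma ideal_generators (J : ideal A) : noetherian A ->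
  exists g : seq A, {in g, forall x, x \in J} /\
    forall N : set V, stable_subgroup (@scalings A V) N -> forall c,
    (forall x, x \in g -> N (x *: c)) -> forall x, x \in J -> N (x *: c).
Proof.
move=> noethA; have [s gen] := noethA J.
exists (map val s); split=> [_ /mapP[x _ ->]|N Nstab c Ng x Jx]; first exact: valP.
have [a Dx] := gen (SubmodType Jx).
have /= -> := etrans (congr1 (@submod_val _ _ J) Dx) (submod_val_sum a _).
rewrite scaler_suml; apply: stable_subgroup_sum => // i; rewrite -scalerA.
apply: scalings_stableZ => //.
by apply: Ng; apply: map_f; apply: mem_nth.
Qed.

End NoetherianModules.

(** * Graded modules over the Rees algebra *)

Section GradedFamilies.
Variables (A : comPzRingType) (V : lmodType A) (d : nat) (J : 'I_d -> ideal A).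
Local Notation stable := (stable_subgroup (@scalings A V)).
Implicit Types (N : ('I_d -> nat) -> set V) (n : 'I_d -> nat) (i j l : 'I_d).

(* N stands for the graded submodule of the direct sum of the N n over the Rees
   algebra of J_1, ..., J_d; the Rees algebra itself is never formed. *)
Definition rees_family N := (forall n, stable (N n)) /\
  forall n j x c, x \in J j -> N n c -> N (incr n j) (x *: c).

Lemma family_subE (f g : ('I_d -> nat) -> V) n : (f - g) n = f n - g n.
Proof. by []. Qed.

Lemma family_scaleE a (f : ('I_d -> nat) -> V) n : (a *: f) n = a *: f n.
Proof. by []. Qed.

(** For [v = (j, x)] with [x] in [J j], this is multiplication by [x] placed in degree e_j of the
    Rees algebra. Nothing arrives in degrees with [n j = 0], where [decr] would truncate. *)
Definition shift_scale (v : 'I_d * A) (f : ('I_d -> nat) -> V) :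
    ('I_d -> nat) -> V :=
  fun n => if n v.1 == 0%N then 0 else v.2 *: f (decr n v.1).

Lemma shift_scaleB v : {morph shift_scale v : f g / f - g}.
Proof.
move=> f g; apply: funext => n; rewrite family_subE /shift_scale family_subE.
by case: ifP => _; rewrite ?subr0 // scalerBr.
Qed.

Lemma shift_scaleZ v a f : shift_scale v (a *: f) = a *: shift_scale v f.
Proof.
apply: funext => n; rewrite family_scaleE /shift_scale family_scaleE.
by case: ifP => _; rewrite ?scaler0 // !scalerA mulrC.
Qed.

Lemma shift_scaleC u v f :
  shift_scale u (shift_scale v f) = shift_scale v (shift_scale u f).
Proof.
case: u v => [i x] [j y]; apply: funext => n; rewrite /shift_scale /=.
have [<-|neq_ij] := eqVneq i j.
  by case: ifP => // _; case: ifP => _; rewrite ?scaler0 // !scalerA mulrC.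
have -> : decr n i j = n j by rewrite /decr eq_sym (negPf neq_ij) subn0.
have -> : decr n j i = n i by rewrite /decr (negPf neq_ij) subn0.
case: ifP => _; first by case: ifP; rewrite ?scaler0.
by case: ifP; rewrite ?scaler0 // !scalerA mulrC decrC.
Qed.

Definition monomial n (c : V) : ('I_d -> nat) -> V :=
  fun k => if k == n then c else 0.

Lemma shift_scale_monomial j x n c :
  shift_scale (j, x) (monomial n c) = monomial (incr n j) (x *: c).
Proof.
apply: funext => k; rewrite /shift_scale /monomial /=.
case: eqP => [k0|/eqP kn0].
  by case: eqP => // Dk; move: k0; rewrite Dk /incr eqxx addn1.
rewrite -lt0n in kn0.
have -> : (decr k j == n) = (k == incr n j).
  by apply/eqP/eqP => [<-|->]; rewrite ?decrK ?incrK.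
by case: ifP => //; rewrite scaler0.
Qed.

Lemma monomialB n : {morph monomial n : c e / c - e}.
Proof.
move=> c e; apply: funext => k; rewrite family_subE.
by rewrite /monomial; case: ifP => //; rewrite subr0.
Qed.

Lemma monomialZ n a c : monomial n (a *: c) = a *: monomial n c.
Proof.
apply: funext => k; rewrite family_scaleE.
by rewrite /monomial; case: ifP => //; rewrite scaler0.
Qed.

Definition shift_operators (r : seq ('I_d * A)) :
    set ((('I_d -> nat) -> V) -> (('I_d -> nat) -> V)) :=
  foldr (fun v S => shift_scale v |` S) (@scalings A (('I_d -> nat) -> V)) r.

(** The families generated from degree zero by the operators of [r], adjoined one at a time as the
    basis theorem requires. *)
Definition shift_span (r : seq ('I_d * A)) : set (('I_d -> nat) -> V) :=
  foldr (fun v M => adjoin_operator (shift_scale v) M)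
    [set f | exists c, f = monomial (@zero_index d) c] r.

Lemma shift_operatorsP r s : shift_operators r s ->
  (exists a, s = *:%R a) \/ exists2 v, v \in r & s = shift_scale v.
Proof.
elim: r => [|v r IHr] /=; first by left.
move=> [->|/IHr [|[w wr ->]]]; first by right; exists v; rewrite ?mem_head.
  by left.
by right; exists w; rewrite // inE wr orbT.
Qed.

Lemma shift_operators_scalings r a : shift_operators r ( *:%R a).
Proof. by elim: r => [|v r IHr] /=; [exists a|right]. Qed.

Lemma shift_operators_mem r v : v \in r -> shift_operators r (shift_scale v).
Proof.
elim: r => //= w r IHr; rewrite inE => /orP[/eqP ->|/IHr]; first by left.
by right.
Qed.

Lemma shift_operatorsB r s : shift_operators r s -> {morph s : f g / f - g}.
Proof.
move=> /shift_operatorsP[[a ->]|[v _ ->]]; last exact: shift_scaleB.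
by move=> f g; rewrite scalerBr.
Qed.

Lemma shift_operatorsC r v s : shift_operators r s ->
  forall f, shift_scale v (s f) = s (shift_scale v f).
Proof.
move=> /shift_operatorsP[[a ->]|[w _ ->]] f; first exact: shift_scaleZ.
exact: shift_scaleC.
Qed.

Lemma shift_span_stable r : stable_subgroup (shift_operators r) (shift_span r).
Proof.
elim: r => [|v r IHr] /=; last first.
  apply: adjoin_operator_stable IHr; first exact: shift_operatorsB.
    exact: shift_scaleB.
  exact: shift_operatorsC.
split.
- by exists 0; apply: funext => k; rewrite /monomial; case: ifP.
- by move=> _ _ [c ->] [e ->]; exists (c - e); rewrite monomialB.
- by move=> _ _ [a ->] [c ->]; exists (a *: c); rewrite monomialZ.
Qed.

Lemma shift_span_noetherian r : noetherian_for (@scalings A V) setT ->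
  noetherian_for (shift_operators r) (shift_span r).
Proof.
move=> noethV; elim: r => [|v r IHr] /=; last first.
  exact: (noetherian_adjoin_operator (@shift_operatorsB r) (@shift_scaleB v)
    (@shift_operatorsC r v) (shift_span_stable r)).
move=> N Nstab NM Ninc.
have [|||m0 m0P] := noethV (fun m => [set c | N m (monomial (@zero_index d) c)]).
- move=> m; have [N0 NB NZ] := Nstab m; split=> /=.
  + by rewrite -(subrr 0) monomialB subrr.
  + by move=> x y Nx Ny; rewrite monomialB; apply: NB.
  + move=> _ x [a ->] Nx; rewrite monomialZ.
    by apply: (NZ ( *:%R a)) => //; exists a.
- by [].
- by move=> m c; apply: Ninc.
- exists m0 => m f Nf; have [c Df] := NM _ _ Nf.
  by rewrite Df; apply: (m0P m); rewrite /= -Df.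
Qed.

Lemma shift_span_monomial0 r c : shift_span r (monomial (@zero_index d) c).
Proof.
by elim: r => [|v r IHr] /=; [exists c|apply: sub_adjoin_operator].
Qed.

Hypothesis noethA : noetherian A.
Hypothesis noethV : noetherian_for (@scalings A V) setT.
Variable JC : ('I_d -> nat) -> set V.
Hypothesis JC_ind : forall n j (N : set V), stable N ->
  (forall x c, x \in J j -> JC n c -> N (x *: c)) -> JC (incr n j) `<=` N.

(** By [JC_ind], [JC] is generated from degree zero by finitely many shift operators, so monomials
    with coefficient in [JC n] lie in a Noetherian [shift_span]. There the families with all
    components in [N m] form a stationary chain, and monomials bring this back to each degree. *)
Lemma rees_family_noetherian (N : nat -> ('I_d -> nat) -> set V) :
    (forall m, rees_family (N m)) -> (forall m n, N m n `<=` JC n) ->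
    (forall m n, N m n `<=` N m.+1 n) ->
  exists m0, forall m n, N m n `<=` N m0 n.
Proof.
move=> Nfam NJ Ninc.
have [g gP] := choice (fun j => ideal_generators V (J j) noethA).
pose r := [seq (j, x) | j <- enum 'I_d, x <- g j].
have rP j x : x \in g j -> (j, x) \in r.
  by move=> gx; apply/allpairsPdep; exists j, x; rewrite mem_enum.
have JCr n c : JC n c -> shift_span r (monomial n c).
  have [M0 MB MS] := shift_span_stable r.
  have leq0 (k : 'I_d -> nat) i : (zero_index i <= k i)%N by [].
  move: n (leq0 n) c; apply: multi_index_ind => [c _|n j _ IHn].
    exact: shift_span_monomial0.
  have Nstab : stable [set c | shift_span r (monomial (incr n j) c)].
    split=> /=.
    - by rewrite -(subrr 0) monomialB subrr.
    - by move=> c e Mc Me; rewrite monomialB; apply: MB.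
    - move=> _ c [a ->] Mc; rewrite monomialZ.
      by apply: (MS ( *:%R a)) => //; apply: shift_operators_scalings.
  (* It suffices to treat products [x *: c] with [x] a generator of [J j]; their monomials are
     shifts of monomials known by induction. *)
  apply: JC_ind => // x c Jx /IHn Mc.
  have [gJ gen] := gP j; move: x Jx; apply: (gen _ Nstab) => x gx /=.
  rewrite -shift_scale_monomial; apply: (MS (shift_scale _)) => //.
  exact/shift_operators_mem/rP.
pose N' m := shift_span r `&` [set f | forall n, N m n (f n)].
have [|||m0 m0P] := shift_span_noetherian noethV (r := r) (N := N').
- move=> m; have [M0 MB MS] := shift_span_stable r.
  have [Nstab Nmul] := Nfam m; split.
  + by split=> // n; have [] := Nstab n.
  + move=> f h [Mf Nf] [Mh Nh]; split; first exact: MB.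
    by move=> n; have [_ NB _] := Nstab n; apply: NB.
  + move=> s f Ss [Mf Nf]; split; first exact: MS.
    move=> n; case: (shift_operatorsP Ss) => [[a ->]|[[j x] vr ->]].
      exact: scalings_stableZ.
    rewrite /shift_scale /=; case: eqP => [_|/eqP n0]; first by have [] := Nstab n.
    rewrite -lt0n in n0; rewrite -{1}(decrK n0); apply: Nmul => //.
    have /allpairsPdep[j' [x' [_ gx [-> ->]]]] := vr.
    by have [gJ _] := gP j'; apply: gJ.
- by move=> m f [].
- by move=> m f [Mf Nf]; split=> // n; apply: Ninc.
exists m0 => m n c Nc.
suff [_ /(_ n)] : N' m0 (monomial n c) by rewrite /monomial eqxx.
apply: (m0P m); split; first exact/JCr/(NJ m).
move=> k; rewrite /monomial; case: eqP => [->|] //.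
by have [Nstab _] := Nfam m; have [] := Nstab k.
Qed.

End GradedFamilies.

(** * Associated primes of quotients *)

Section AssociatedPrimes.
Variables (A : comPzRingType) (V : lmodType A).
Local Notation stable := (stable_subgroup (@scalings A V)).
Implicit Types (M N B : set V) (p : {pred A}).

(** For submodules, the associated primes of [M / (M :&: N)] in terms of representatives, so that
    all quotients are compared inside one [V]. *)
Definition ass_quotient M N : set {pred A} :=
  [set p | prime_ideal p /\
    exists x, M x /\ forall a : A, a \in p <-> N (a *: x)].

Lemma prime_idealMl p a b : prime_ideal p -> b \in p -> a * b \in p.
Proof.
move=> [[p0 pD] _ _] pb; have := pD a b 0 pb p0.
by rewrite addr0.
Qed.

Lemma prime_ideal_mulP p a b : prime_ideal p -> a \notin p ->
  (b * a \in p) = (b \in p).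
Proof.
move=> pP /negPf pa; have [_ _ pM] := pP; apply/idP/idP => [/pM|pb].
  by rewrite pa orbF.
by rewrite mulrC; apply: prime_idealMl.
Qed.

Lemma ass_quotientS M M' N : M `<=` M' ->
  ass_quotient M N `<=` ass_quotient M' N.
Proof. by move=> MM' p [pP [x [Mx xP]]]; split=> //; exists x; split=> //; apply: MM'. Qed.

(** Let [p] be the annihilator of [x] modulo [B]. If some [a] outside [p] sends [x] into [N], then
    [a *: x] still has annihilator [p] modulo [B], as [p] is prime; otherwise [x] has annihilator
    [p] modulo [N] too. *)
Lemma ass_quotient_extension M N B : stable M -> B `<=` N ->
  ass_quotient M B `<=` ass_quotient (M `&` N) B `|` ass_quotient M N.
Proof.
move=> Mstab BN p [pP [x [Mx xP]]].
have [[a [pa Na]]|noa] := pselect (exists a, a \notin p /\ N (a *: x)).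
  left; split=> //; exists (a *: x); split; first by split=> //; apply: scalings_stableZ.
  by move=> b; rewrite scalerA -xP (prime_ideal_mulP b pP pa).
right; split=> //; exists x; split=> // a; split=> [/xP/BN //|Na].
by apply: contrapT => /negP pa; apply: noa; exists a.
Qed.

(** Multiplications by the members of [g] jointly embed the first quotient in a power of the second.
    If [p] were not associated to the second, each [y *: x] would be sent into [N'] by a scalar
    outside [p]; the product of these scalars is outside [p] and sends [x] into [N]. *)
Lemma ass_quotient_mul M N M' N' (g : seq A) p :
    (forall x c, x \in g -> M c -> M' (x *: c)) ->
    (forall x c, x \in g -> N c -> N' (x *: c)) ->
    stable N' ->
    (forall c, M c -> (forall x, x \in g -> N' (x *: c)) -> N c) ->
    stable M ->
  ass_quotient M N p -> ass_quotient M' N' p.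
Proof.
move=> MM' NN' N'stab tors Mstab [pP [x [Mx xP]]].
apply: contrapT => notass.
suff [b [pb Nb]] : exists b, b \notin p /\
    forall y, y \in g -> N' (y *: (b *: x)).
  by move/negP: pb; apply; apply/xP/tors => //; apply: scalings_stableZ.
have gg : {subset g <= g} by [].
(* The induction is over lists of members of [g], with one factor of [b] for each. *)
elim: {-2}g gg => [|y r IHr] rg.
  by exists 1; split=> //; case: pP.
have [|b [pb Nb]] := IHr; first by move=> z zr; apply: rg; rewrite inE zr orbT.
have gy : y \in g by apply: rg; rewrite mem_head.
have [a [pa Na]] : exists a, a \notin p /\ N' (a *: (y *: x)).
  apply: contrapT => noa; apply: notass; split=> //; exists (y *: x).
  split=> [|a]; first exact: MM'.
  split=> [/xP Na|Na].
    by rewrite scalerA mulrC -scalerA; apply: NN'.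
  by apply: contrapT => /negP pa; apply: noa; exists a.
exists (b * a); split; first by rewrite prime_ideal_mulP.
move=> z; rewrite inE => /orP[/eqP ->|zr].
  have -> : y *: (b * a *: x) = b *: (a *: (y *: x)).
    by rewrite !scalerA [in LHS]mulrC.
  exact: scalings_stableZ.
have -> : z *: (b * a *: x) = a *: (z *: (b *: x)).
  by rewrite !scalerA [b * a]mulrC mulrCA -mulrA.
by apply: scalings_stableZ => //; apply: Nb.
Qed.

End AssociatedPrimes.

(** * Asymptotic stability of associated primes *)

Section Stability.
Variables (A : comPzRingType) (V : lmodType A) (d : nat) (J : 'I_d -> ideal A).
Local Notation stable := (stable_subgroup (@scalings A V)).
Implicit Types (n : 'I_d -> nat) (i j l : 'I_d) (p : {pred A}).

Hypothesis noethA : noetherian A.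
Hypothesis noethV : noetherian_for (@scalings A V) setT.
Variable JC : ('I_d -> nat) -> set V.
Hypothesis JC_family : rees_family J JC.
Hypothesis JC0 : forall c, JC (@zero_index d) c.
Hypothesis JC_ind : forall n j (N : set V), stable N ->
  (forall x c, x \in J j -> JC n c -> N (x *: c)) -> JC (incr n j) `<=` N.

Let JC_stable n : stable (JC n). Proof. by have [+ _] := JC_family; apply. Qed.

Let JC_mul n j x c : x \in J j -> JC n c -> JC (incr n j) (x *: c).
Proof. by have [_] := JC_family; apply. Qed.

Lemma JC_decr n j : JC (incr n j) `<=` JC n.
Proof. by apply: JC_ind => // x c _; apply: scalings_stableZ. Qed.

Let shifted_family i : rees_family J (fun n => JC (incr n i)).
Proof.
split=> [n|n j x c Jx Bc]; first exact: JC_stable.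
by rewrite incrC; apply: JC_mul.
Qed.

(* The elements of degree n killed by J_j in the graded module with components
   JC n / JC (incr n i) form a Noetherian graded module killed by J_j, so they
   vanish once n j is large. *)
Lemma eventually_torsion_free i j : exists b, forall n c, (b <= n j)%N ->
  JC n c -> (forall x, x \in J j -> JC (incr (incr n i) j) (x *: c)) ->
  JC (incr n i) c.
Proof.
pose tors n := JC n `&`
  [set c | forall x, x \in J j -> JC (incr (incr n i) j) (x *: c)].
have tors_stable n : stable (tors n).
  have [N0 NB NZ] := JC_stable n.
  have [B0 BB BZ] := JC_stable (incr (incr n i) j).
  split.
  - by split=> // x _; rewrite scaler0.
  - move=> c e [Nc Tc] [Ne Te]; split; first exact: NB.
    by move=> x Jx; rewrite scalerBr; apply: BB; [apply: Tc|apply: Te].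
  - move=> _ c [a ->] [Nc Tc]; split; first exact: scalings_stableZ.
    move=> x Jx; rewrite scalerA mulrC -scalerA; apply: scalings_stableZ => //.
    exact: Tc.
have sub_tors n : JC (incr n i) `<=` tors n.
  by move=> c Bc; split=> [|x Jx]; [apply: JC_decr Bc|apply: JC_mul].
(* The torsion is kept only where [n j < m]. This is a graded submodule: [J j] kills the torsion,
   and the other [J l] leave [n j] unchanged. Where the chain in [m] stops, the torsion of larger
   degree in direction [j] has vanished. *)
pose N m n := if (n j < m)%N then tors n else JC (incr n i).
have subN m n : JC (incr n i) `<=` N m n.
  by move=> c; rewrite /N; case: ifP => // _ /sub_tors.
have Nfam m : rees_family J (N m).
  split=> [n|n l x c Jx]; first by rewrite /N; case: ifP.
  rewrite {1}/N; case: ifP => [lt_n [Nc Tc]|_ Bc]; last first.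
    by apply: subN; rewrite incrC; apply: JC_mul.
  have [eq_lj|neq_lj] := eqVneq l j.
    by apply: subN; rewrite eq_lj in Jx *; rewrite incrC; apply: Tc.
  rewrite /N {1}/incr eq_sym (negPf neq_lj) addn0 lt_n; split; first exact: JC_mul.
  move=> y Jy; rewrite scalerA mulrC -scalerA (incrC n l i) (incrC _ l j).
  by apply: JC_mul => //; apply: Tc.
have [|m n c|b bP] := rees_family_noetherian noethA noethV JC_ind Nfam.
- by move=> m n c; rewrite /N; case: ifP => _; [case|apply: JC_decr].
- rewrite /N; case: ifP => [lt_n|_]; first by rewrite ltnS ltnW.
  by case: ifP => // _ /sub_tors.
exists b => n c le_b Nc Tc; have := bP (n j).+1 n c.
by rewrite /N ltnSn ltnNge le_b; apply.
Qed.

(* Enlarge a graded submodule N to (N : q), where q is maximal among the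
   annihilators of homogeneous elements outside N: this adds at most the
   associated prime q. *)
Lemma finite_ass_step i : exists L : seq {pred A}, forall n p,
  ass_quotient (JC n) (JC (incr n i)) p -> p \in L.
Proof.
(* A maximal [N] satisfying [P] will turn out to contain every [JC n]. *)
pose P (N : ('I_d -> nat) -> set V) := [/\ rees_family J N,
  forall n, JC (incr n i) `<=` N n, forall n, N n `<=` JC n &
  exists L : seq {pred A}, forall n p, ass_quotient (N n) (JC (incr n i)) p -> p \in L].
have P0 : P (fun n => JC (incr n i)).
  split; [exact: shifted_family|by move=> n c|by move=> n; apply: JC_decr|].
  exists [::] => n p [[_ p1 _] [x [Bx xP]]].
  by case/negP: p1; apply/xP; rewrite scale1r.
have [|N [[Nfam BN NJ [L LP]] Nmax]] := exists_maximal P0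
  (le := fun N N' => forall n, N n `<=` N' n).
  move=> t Pt t_inc; have [| | |m0 m0P] :=
    rees_family_noetherian noethA noethV JC_ind (N := t).
  - by move=> m; have [] := Pt m.
  - by move=> m n; have [_ _ ? _] := Pt m.
  - by move=> m n; apply: t_inc.
  - by exists m0; apply: m0P.
have [Nstab Nmul] := Nfam.
exists L => n p assp; apply: (LP n); apply: (ass_quotientS _ assp).
apply: contrapT => /existsNP[c0 /not_implyP[Jc0 Nc0]].
pose ann m (x : V) : set A^o := [set a | N m (a *: x)].
have [||q [[m [x [Jx Nx Dq]]] qmax]] := @exists_maximal (set A^o)
  (fun t => exists m x, [/\ JC m x, ~ N m x & t = ann m x]) subset (ann n c0).
- by exists n, c0.
- move=> t Pt t_inc; have [|//||b bP] := noetherian_ideals noethA (N := t).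
  + move=> b; have [m [x [_ _ ->]]] := Pt b; have [N0 NB NZ] := Nstab m.
    split.
    * by rewrite /ann /= scale0r.
    * by move=> a e Na Ne; rewrite /ann /= scalerBl; apply: NB.
    * move=> _ a [e ->] Na; rewrite /ann /= -scalerA.
      exact: scalings_stableZ.
  + by move=> b; apply: t_inc.
  + by exists b; apply: bP.
pose N' k := JC k `&` [set c | forall a, q a -> N k (a *: c)].
have NN' k : N k `<=` N' k.
  by move=> c Nc; split=> [|a _]; [apply: NJ|apply: scalings_stableZ].
(* [x] lies in [N' m] but not in [N m], so [P N'] contradicts the maximality of [N]. *)
suff PN' : P N'.
  apply: Nx; apply: (Nmax _ PN' NN'); split=> // a.
  by rewrite Dq.
have N'stab k : stable (N' k).
  have [J0 JB JZ] := JC_stable k; have [N0 NB NZ] := Nstab k; split.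
  - by split=> // a _; rewrite scaler0.
  - move=> c e [Jc Nc] [Je Ne]; split; first exact: JB.
    by move=> a qa; rewrite scalerBr; apply: NB; [apply: Nc|apply: Ne].
  - move=> _ c [e ->] [Jc Nc]; split; first exact: scalings_stableZ.
    move=> a qa; rewrite scalerA mulrC -scalerA; apply: scalings_stableZ => //.
    exact: Nc.
split=> //.
- split=> // k j y c Jy [Jc Nc]; split; first exact: JC_mul.
  by move=> a qa; rewrite scalerA mulrC -scalerA; apply: Nmul => //; apply: Nc.
- by move=> k c /BN /NN'.
- by move=> k c [].
exists ((fun a : A => `[< q a >] : bool) :: L) => k r.
move=> /(ass_quotient_extension (N'stab k) (BN k)) [/ass_quotientS assr|].
  by rewrite inE (LP k) ?orbT //; apply: assr => c [].
(* [r] is the annihilator of [y] modulo [N k] and contains [q], since [y] is in [N' k]. As [1] is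
   not in [r], [y] is outside [N k], and maximality of [q] gives equality. *)
move=> [[_ r1 _] [y [[Jy qy] yP]]]; rewrite inE; apply/orP; left; apply/eqP.
apply: funext => a; apply/idP/asboolP => [ra|qa]; last by apply/yP/qy.
apply: (qmax (ann k y)) => //; last exact/yP.
exists k, y; split=> // Ny; case/negP: r1; apply/yP.
by rewrite scale1r.
Qed.
(** Descend from [JC 0], which is all of [V], to [JC n] by unit steps: a step in direction [i] adds
    only primes from the list for [i], whatever the degree. *)
Lemma finite_ass : exists L : seq {pred A}, forall n p,
  ass_quotient setT (JC n) p -> p \in L.
Proof.
have [F FP] := choice finite_ass_step.
exists (flatten [seq F i | i <- enum 'I_d]) => n.
have leq0 (k : 'I_d -> nat) i : (zero_index i <= k i)%N by [].
move: n (leq0 n); apply: multi_index_ind => [p [[_ p1 _] [x [_ xP]]]|n i _ IHn p].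
  by case/negP: p1; apply/xP; apply: JC0.
have stableT : stable setT by [].
move/(ass_quotient_extension stableT (@JC_decr n i)) => [assp|/IHn //].
apply/flattenP; exists (F i); first by apply: map_f; rewrite mem_enum.
by apply: (FP i n); apply: ass_quotientS assp => x [].
Qed.

Variable IC : ('I_d -> nat) -> set V.
Hypothesis IC_family : rees_family J IC.
Hypothesis IC_decr : forall n j, IC (incr n j) `<=` IC n.

(** The numerator of H^i_n; the denominator [JC (incr n i)] is given in each [ass_quotient]. *)
Let kernel i n := JC n `&` IC (incr n i).

(** In large degrees, by torsion-freeness, multiplications by generators of [J j] are jointly
    injective on H^i_n, so Ass H^i_n increases with [n], inside the finite list of [finite_ass]. *)
Lemma kernel_ass_stationary i : exists k, forall n p,
  (forall j, (k j <= n j)%N) ->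
  ass_quotient (kernel i n) (JC (incr n i)) p <->
  ass_quotient (kernel i k) (JC (incr k i)) p.
Proof.
have [b bP] := choice (eventually_torsion_free i).
have [IC_stable IC_mul] := IC_family.
have [L LP] := finite_ass.
have ass_incr n j p : (forall l, (b l <= n l)%N) ->
    ass_quotient (kernel i n) (JC (incr n i)) p ->
    ass_quotient (kernel i (incr n j)) (JC (incr (incr n j) i)) p.
  move=> le_bn; have [g [gJ gen]] := ideal_generators V (J j) noethA.
  have kernel_stable : stable (kernel i n).
    have [J0 JB JZ] := JC_stable n; have [I0 IB IZ] := IC_stable (incr n i).
    split=> // [c e [Jc Ic] [Je Ie]|s c Ss [Jc Ic]].
      by split; [apply: JB|apply: IB].
    by split; [apply: JZ|apply: IZ].
  apply: (ass_quotient_mul (g := g)) => // [x c /gJ gx [Jc Ic]|x c /gJ gx Bc|c [Jc _] Bc].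
  - by split; [apply: JC_mul|rewrite incrC; apply: IC_mul].
  - by rewrite incrC; apply: JC_mul.
  - apply: (bP j) => // x; rewrite incrC.
    exact: (gen _ (JC_stable _)).
have [k [_ kP]] := eventually_stationary L ass_incr.
exists k => n p le_kn.
have [pL|pL] := boolP (p \in L); first exact: kP.
by split=> assp; case/negP: pL; apply: LP; apply: ass_quotientS assp.
Qed.

Lemma ass_stationary : exists k, forall n, (forall j, (k j <= n j)%N) ->
  ass_quotient (IC n) (JC n) = ass_quotient (IC k) (JC k).
Proof.
have [b bP] := choice kernel_ass_stationary.
have [IC_stable IC_mul] := IC_family.
have [L LP] := finite_ass.
(* The successor leaves room to lower a coordinate of [n] by one and stay beyond every [b i]. *)
pose k0 (j : 'I_d) := (\max_i b i j).+1.
(* Ass E_n decreases, so [eventually_stationary], made for increasing properties, is applied to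
   non-membership. *)
have ass_decr n i p : (forall j, (k0 j <= n j)%N) ->
    ~ ass_quotient (IC n) (JC n) p ->
    ~ ass_quotient (IC (incr n i)) (JC (incr n i)) p.
  move=> le_kn notass.
  move/(ass_quotient_extension (IC_stable _) (@JC_decr n i)) => [assp|]; last first.
    by move/(ass_quotientS (@IC_decr n i)).
  apply: notass.
  have n_gt0 : (0 < n i)%N by apply: leq_trans (le_kn i).
  rewrite -(decrK n_gt0); set m := decr n i.
  have le_bm j : (b i j <= m j)%N.
    rewrite /m /decr; apply: (@leq_trans (k0 j).-1).
      by rewrite /k0 /=; apply: (leq_bigmax (F := fun i => b i j)).
    rewrite -subn1; apply: (leq_trans (leq_sub2r _ (le_kn j))).
    by rewrite leq_sub2l //; case: (_ == _).
  have le_bn j : (b i j <= n j)%N by apply: leq_trans (le_bm j) (leq_subr _ _).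
  have {}assp : ass_quotient (kernel i n) (JC (incr n i)) p.
    by apply: ass_quotientS assp => c [].
  (* By stationarity a prime of H^i_n is one of H^i_m, and H^i_m with m = n - e_i is a submodule of
     E_n. *)
  move/(bP i n p le_bn)/(bP i m p le_bm): assp.
  by apply: ass_quotientS => c [].
have [k [_ kP]] := eventually_stationary L ass_decr.
exists k => n le_kn; apply/seteqP; split=> p assp; apply: contrapT => notass.
  have pL : p \in L by apply: LP (ass_quotientS _ assp).
  by apply/(kP n p pL le_kn): notass.
have pL : p \in L by apply: LP (ass_quotientS _ assp).
by move/(kP n p pL le_kn): notass.
Qed.

End Stability.

(** * Products of ideals and submodules *)

Section Products.
Variable A : comPzRingType.

Lemma submodule_ext (V : lmodType A) (M N : submodule V) : M =i N -> M = N.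
Proof.
case: M N => [M cM] [N cN] MN; have {MN}MN : M = N by apply: funext => x; apply: MN.
by case: N / MN cN => cN; rewrite (Prop_irrelevance cM cN).
Qed.

Lemma mem_smul (V : lmodType A) (I : ideal A) (M : submodule V) a m :
  a \in I -> m \in M -> a *: m \in smul I M.
Proof.
move=> Ia Mm; apply/asboolP; exists [:: (a, m)]; rewrite big_seq1.
by split=> // p; rewrite inE => /eqP ->.
Qed.

Lemma smul_ind (V : lmodType A) (I : ideal A) (M : submodule V) (P : V -> Prop) :
    P 0 -> (forall x y, P x -> P y -> P (x + y)) ->
    (forall a m, a \in I -> m \in M -> P (a *: m)) ->
  forall x, x \in smul I M -> P x.
Proof.
move=> P0 PD PM x /asboolP[s [sP ->]]; rewrite big_seq.
by elim/big_ind: _ => // p /sP[]; apply: PM.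
Qed.

Lemma smul_sub (V : lmodType A) (I : ideal A) (M N : submodule V) :
    (forall a m, a \in I -> m \in M -> a *: m \in N) ->
  {subset smul I M <= N}.
Proof. by move=> IMN; apply: smul_ind => // [|x y]; [apply: rpred0|apply: rpredD]. Qed.

Lemma smulS (V : lmodType A) (I I' : ideal A) (M M' : submodule V) :
  {subset I <= I'} -> {subset M <= M'} -> {subset smul I M <= smul I' M'}.
Proof. by move=> sI sM; apply: smul_sub => a m /sI Ia /sM; apply: mem_smul. Qed.

Lemma smulA (V : lmodType A) (I I' : ideal A) (M : submodule V) :
  smul I (smul I' M) = smul (smul I I') M.
Proof.
apply: submodule_ext => x; apply/idP/idP; move: x; apply: smul_sub => a m Ia.
  move: m; apply: smul_ind => [|x y|b m Ib Mm]; rewrite ?scaler0 ?rpred0 //.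
    by rewrite scalerDr; apply: rpredD.
  by rewrite scalerA; apply: mem_smul Mm; apply: (mem_smul Ia Ib).
move=> Mm; move: a Ia; apply: smul_ind => [|x y|a b Ia Ib].
- by rewrite scale0r rpred0.
- by rewrite scalerDl; apply: rpredD.
- by rewrite -scalerA; do 2!apply: mem_smul => //.
Qed.

Lemma smulC (I I' : ideal A) : smul I I' = smul I' I.
Proof.
apply: submodule_ext => x; apply/idP/idP; move: x; apply: smul_sub => a b Ia Ib;
  by rewrite [_ *: _]mulrC; apply: mem_smul.
Qed.

Lemma smul_full (V : lmodType A) (M : submodule V) : smul (full A^o) M = M.
Proof.
apply: submodule_ext => x; apply/idP/idP => [|Mx].
  by move: x; apply: smul_sub => a m _; apply: rpredZ.
by rewrite -[x]scale1r; apply: mem_smul.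
Qed.

(** Lets a single factor be extracted from [ideal_prod] by [bigD1]. *)
HB.instance Definition _ := Monoid.isComLaw.Build (ideal A) (full A^o)
  (@smul A A^o) (@smulA A^o) smulC (@smul_full A^o).

Lemma ideal_prodS d (I I' : 'I_d -> ideal A) :
  (forall i, {subset I i <= I' i}) -> {subset ideal_prod I <= ideal_prod I'}.
Proof.
move=> sI; rewrite /ideal_prod.
by elim/big_ind2: _ => // *; apply: smulS.
Qed.

Lemma ideal_prod_factor d (I I' : 'I_d -> ideal A) (J : ideal A) j :
    (forall i, i != j -> I' i = I i) -> I' j = smul J (I j) ->
  ideal_prod I' = smul J (ideal_prod I).
Proof.
move=> eqI Dj; rewrite /ideal_prod (bigD1 j) //= [in RHS](bigD1 j) //= Dj smulA.
by congr smul; apply: eq_bigr.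
Qed.

End Products.

(** * From quotient modules to representatives *)

Section AssSubquotient.
Local Open Scope quotient_scope.
Variables (A : comPzRingType) (V : lmodType A) (M N : submodule V).

Lemma annihilator_subquot (x : submod_type M) (a : A) :
  (a \in annihilator (\pi_(quot_mod (restr M N)) x : subquot M N)) =
  (a *: submod_val x \in N).
Proof.
have pi0 : \pi_(quot_mod (restr M N)) 0 = 0.
  apply: (@addrI _ (\pi_(quot_mod (restr M N)) 0)).
  by rewrite -pi_quotD !addr0.
rewrite unfold_in /annihilator -pi0.
have -> : a *: (\pi_(quot_mod (restr M N)) x : subquot M N) =
    \pi_(quot_mod (restr M N)) (a *: x) by rewrite pi_quotZ.
by rewrite pi_quotE subr0.
Qed.

Lemma Ass_subquotE :
  Ass (subquot M N) = ass_quotient [set x | x \in M] [set x | x \in N].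
Proof.
apply/seteqP; split=> p [pP].
  move=> [z Dp]; split=> //; exists (submod_val (repr z)).
  split=> [|a]; first exact: submod_valP.
  by rewrite Dp -[z in annihilator z]reprK annihilator_subquot.
move=> [x [Mx xP]]; split=> //.
exists (\pi_(quot_mod (restr M N)) (SubmodType Mx)).
apply: funext => a; rewrite -[RHS]/(a \in annihilator _) annihilator_subquot.
by apply/idP/idP => /xP.
Qed.

End AssSubquotient.

Theorem theorem1p1 (A : comPzRingType) (C : lmodType A) (d : nat)
    (J : 'I_d -> ideal A) (I : 'I_d -> nat -> ideal A)
    (noethA : noetherian A) (fgC : finitely_generated C)
    (I0 : forall i : 'I_d, I i 0%N =i full A^o)
    (JI : forall (i : 'I_d) (m : nat), {subset ideal_exp (J i) m <= I i m})
    (Idecr : forall (i : 'I_d) (m n : nat),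
       (m <= n)%N -> {subset I i n <= I i m})
    (JII : forall (i : 'I_d) (r s : nat),
       {subset smul (ideal_exp (J i) r) (I i s) <= I i (r + s)%N}) :
  exists k : 'I_d -> nat, forall n : 'I_d -> nat,
    (forall i : 'I_d, (k i <= n i)%N) ->
    Ass (subquot (smul (ideal_prod (fun i => I i (n i))) (full C))
                 (smul (ideal_prod (fun i => ideal_exp (J i) (n i))) (full C)))
    = Ass (subquot (smul (ideal_prod (fun i => I i (k i))) (full C))
                 (smul (ideal_prod (fun i => ideal_exp (J i) (k i))) (full C))).
Proof.
pose JC (n : 'I_d -> nat) := smul (ideal_prod (fun i => ideal_exp (J i) (n i))) (full C).
pose IC (n : 'I_d -> nat) := smul (ideal_prod (fun i => I i (n i))) (full C).
(* This equality yields both the grading [JCJ] and the generation property [JC_ind]; for [IC] only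
   an inclusion is available. *)
have JCE n j : JC (incr n j) = smul (J j) (JC n).
  rewrite /JC smulA; congr smul; apply: (ideal_prod_factor (j := j)) => [i neq_ij|].
    by rewrite /incr (negPf neq_ij) addn0.
  by rewrite /incr eqxx addn1.
have ICJ n j x c : x \in J j -> c \in IC n -> x *: c \in IC (incr n j).
  move=> Jx Ic; have : x *: c \in smul (J j) (IC n) by apply: mem_smul.
  rewrite /IC smulA; apply: smulS => //.
  (* The product of [I'] is [J j] times the product for [n]; factor by factor it is contained in the
     product for [incr n j], by (iv) with [r = 1]. *)
  pose I' i := if i == j then smul (J j) (I j (n j)) else I i (n i).
  rewrite -(@ideal_prod_factor _ _ _ I' _ j).
  - apply: (@ideal_prodS A d I' (fun i => I i (incr n j i))) => i.
    rewrite /I' /incr; case: eqP => [->|_].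
      rewrite addn1 => y Jy; apply: (JII j 1%N).
      suff -> : ideal_exp (J j) 1 = J j by [].
      by rewrite -[LHS]/(smul (J j) (full _)) smulC smul_full.
    by rewrite addn0.
  - by move=> i /negPf; rewrite /I' => ->.
  - by rewrite /I' eqxx.
have JCJ n j x c : x \in J j -> c \in JC n -> x *: c \in JC (incr n j).
  by rewrite JCE; apply: mem_smul.
have JC0 c : c \in JC (@zero_index d).
  by rewrite /JC /ideal_prod big1 // smul_full.
have JC_ind n j (N : set C) : stable_subgroup (@scalings A C) N ->
    (forall x c, x \in J j -> c \in JC n -> N (x *: c)) ->
    forall c, c \in JC (incr n j) -> N c.
  move=> Nstab NJ; rewrite JCE; apply: smul_ind => //; first by case: Nstab.
  by move=> x y; apply: stable_subgroupD Nstab.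
have IC_decr n j c : c \in IC (incr n j) -> c \in IC n.
  apply: smulS => //; apply: ideal_prodS => i; apply: Idecr; exact: leq_addr.
have [|||||k kP] := @ass_stationary A C d J noethA (noetherian_module noethA fgC)
  (fun n => [set x | x \in JC n]) _ _ _ (fun n => [set x | x \in IC n]).
- by split=> [n|n j x c]; [apply: submodule_stable|apply: JCJ].
- exact: JC0.
- exact: JC_ind.
- by split=> [n|n j x c]; [apply: submodule_stable|apply: ICJ].
- exact: IC_decr.
by exists k => n le_kn; rewrite !Ass_subquotE; apply: kP.
Qed.
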